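(* Let $(M,L)$ be a polarized manifold such that $L$ is effective and $2$-generated. Then $2L$ is very ample.
   Context: A polarized manifold $(M,L)$ is a smooth projective (connected) variety $M$ over $\mathbb{C}$ together with an ample line bundle $L$ on $M$. The tensor powers of $L$ are written additively: $iL=L^{\otimes i}$. $L$ is effective if $H^0(M,L)\neq 0$. $L$ is called $2$-generated if the graded algebra $G(M,L)=\bigoplus_{i\geq 1}H^0(M,iL)$ is generated by the sections of $H^0(M,L)$ and $H^0(M,2L)$, i.e. every section of every $kL$ with $k\ge 1$ is a $\mathbb{C}$-linear combination of products of sections belonging to $H^0(M,L)$ or $H^0(M,2L)$. *)

(* Defs.v *)
(* Classical (Hartshorne, Chapter I) algebraic geometry over
   C = R[i], with R : realType: varieties are subsets of projective spaces,
   line bundles are given by transition functions. *)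
From HB Require Import structures.
From mathcomp Require Import all_boot all_order all_algebra.
From mathcomp Require Import mpoly complex.
From mathcomp Require Import boolp classical_sets reals.

Set Implicit Arguments.
Unset Strict Implicit.
Unset Printing Implicit Defensive.

Import Order.TTheory GRing.Theory Num.Theory.
Local Open Scope classical_set_scope.
Local Open Scope ring_scope.
Local Open Scope complex_scope.

(* P^n(C): the lines of C^(n+1). *)
Definition pspace (R : realType) (n : nat) : Type :=
  {l : {vspace 'rV[R[i]]_n.+1} | \dim l == 1%N}.

(* A choice of homogeneous coordinates.  It is only used in expressions that
   do not depend on it: the vanishing of a homogeneous polynomial, or the
   quotient of two homogeneous polynomials of the same degree. *)
Definition hcoord (R : realType) (n : nat) (x : pspace R n) : 'I_n.+1 -> R[i] :=
  fun j => vpick (val x) 0 j.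

Definition homogeneous (R : realType) (n : nat) (p : {mpoly R[i][n.+1]}) : Prop :=
  exists d : nat, p \is d.-homog.

(* The Zariski topology of P^n. *)

Definition zclosed (R : realType) (n : nat) (Z : set (pspace R n)) : Prop :=
  exists2 S : set {mpoly R[i][n.+1]},
    (forall p, S p -> homogeneous p) &
    Z = [set x | forall p, S p -> p.@[hcoord x] = 0].

Definition zopen (R : realType) (n : nat) (U : set (pspace R n)) : Prop :=
  zclosed (~` U).

Definition locally_closed (R : realType) (n : nat) (Y : set (pspace R n)) : Prop :=
  exists Z U : set (pspace R n), [/\ zclosed Z, zopen U & Y = Z `&` U].

Definition irreducible (R : realType) (n : nat) (X : set (pspace R n)) : Prop :=
  X !=set0 /\
  forall Z1 Z2 : set (pspace R n), zclosed Z1 -> zclosed Z2 ->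
    X `<=` Z1 `|` Z2 -> X `<=` Z1 \/ X `<=` Z2.

Definition projective_variety (R : realType) (n : nat) (X : set (pspace R n)) : Prop :=
  zclosed X /\ irreducible X.

(* Krull dimension of a closed set X. *)

Definition irreducible_chain (R : realType) (n : nat) (X : set (pspace R n))
    (k : nat) (Z : nat -> set (pspace R n)) : Prop :=
  (forall j, (j <= k)%N -> projective_variety (Z j) /\ Z j `<=` X) /\
  (forall j, (j < k)%N -> Z j `<` Z j.+1).

Definition has_dim (R : realType) (n : nat) (X : set (pspace R n)) (r : nat) : Prop :=
  (exists Z, irreducible_chain X r Z) /\
  (forall k Z, irreducible_chain X k Z -> (k <= r)%N).

(* Jacobian criterion.  T is the tangent space, at a point over x, of the
   affine cone over X; this is why its dimension is dim X + 1. *)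
Definition smooth (R : realType) (n : nat) (X : set (pspace R n)) : Prop :=
  exists2 r : nat, has_dim X r &
    forall x, X x -> exists2 T : {vspace 'rV[R[i]]_n.+1}, \dim T = r.+1 &
      forall w : 'rV[R[i]]_n.+1, w \in T <->
        (forall p : {mpoly R[i][n.+1]}, homogeneous p ->
           (forall y, X y -> p.@[hcoord y] = 0) ->
           \sum_(j < n.+1) (mderiv j p).@[hcoord x] * w 0 j = 0).

(* Regular functions (Hartshorne I.3) on a locally closed set Y.  Values
   outside Y are irrelevant. *)
Definition regular_on (R : realType) (n : nat) (Y : set (pspace R n))
    (f : pspace R n -> R[i]) : Prop :=
  forall x, Y x -> exists W : set (pspace R n), [/\ zopen W, W x &
    exists (d : nat) (p q : {mpoly R[i][n.+1]}),
      [/\ p \is d.-homog, q \is d.-homog &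
          forall y, Y y -> W y ->
            q.@[hcoord y] != 0 /\ f y = p.@[hcoord y] / q.@[hcoord y]]].

(* Morphisms Y -> Z of locally closed sets (Hartshorne I.3): continuous maps
   pulling back regular functions on open subsets to regular functions. *)
Definition morphism (R : realType) (n m : nat) (Y : set (pspace R n))
    (Z : set (pspace R m)) (phi : pspace R n -> pspace R m) : Prop :=
  [/\ forall x, Y x -> Z (phi x),
      forall V, zopen V ->
        exists2 U, zopen U & Y `&` (phi @^-1` V) = Y `&` U &
      forall V f, zopen V -> regular_on (Z `&` V) f ->
        regular_on (Y `&` (phi @^-1` V)) (f \o phi)].

(* Immersions (Hartshorne II.5): isomorphisms onto a locally closed image.
   When X is projective the image is then closed in P^m. *)
Definition immersion (R : realType) (n m : nat) (X : set (pspace R n))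
    (phi : pspace R n -> pspace R m) : Prop :=
  [/\ locally_closed (phi @` X),
      morphism X (phi @` X) phi &
      exists2 psi : pspace R m -> pspace R n,
        morphism (phi @` X) X psi & forall x, X x -> psi (phi x) = x].

Lemma regular_onX (R : realType) (n : nat) (Y : set (pspace R n))
    (f : pspace R n -> R[i]) (k : nat) :
  regular_on Y f -> regular_on Y (fun x => f x ^+ k).
Proof.
move=> rf x Yx; have [W [oW Wx [d [p [q [hp hq E]]]]]] := rf x Yx.
exists W; split => //; exists (d * k)%N, (p ^+ k), (q ^+ k).
have hX (u : {mpoly R[i][n.+1]}) : u \is d.-homog -> u ^+ k \is (d * k).-homog.
  move=> hu; elim: k => [|k IHk]; first by rewrite muln0 expr0 dhomog1.
  by rewrite exprS mulnS; apply: dhomogM.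
split; [exact: hX | exact: hX |] => y Yy Wy; have [q0 ->] := E y Yy Wy.
by rewrite !rmorphXn /= expf_eq0 negb_and q0 orbT expr_div_n.
Qed.

(* A line bundle on X: it is trivial on each X `&` lb_open i, and
   lb_trans i j is the transition function from the trivialization j to the
   trivialization i. *)
Record line_bundle (R : realType) (n : nat) (X : set (pspace R n)) := LineBundle {
  lb_index : Type;
  lb_open : lb_index -> set (pspace R n);
  lb_trans : lb_index -> lb_index -> pspace R n -> R[i];
  lb_open_zopen : forall i, zopen (lb_open i);
  lb_cover : forall x, X x -> exists i, lb_open i x;
  lb_trans_regular : forall i j,
    regular_on (X `&` (lb_open i `&` lb_open j)) (lb_trans i j);
  lb_trans_id : forall i x, X x -> lb_open i x -> lb_trans i i x = 1;
  lb_trans_cocycle : forall i j k x, X x ->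
    lb_open i x -> lb_open j x -> lb_open k x ->
    lb_trans i j x * lb_trans j k x = lb_trans i k x
}.

Section Power.
Variables (R : realType) (n : nat) (X : set (pspace R n)) (L : line_bundle X).
Variable k : nat.

Let trans_pow (i j : lb_index L) x := lb_trans i j x ^+ k.

Lemma lb_pow_regular i j :
  regular_on (X `&` (lb_open i `&` lb_open j)) (trans_pow i j).
Proof. by apply: regular_onX; exact: lb_trans_regular. Qed.

Lemma lb_pow_id i x : X x -> lb_open i x -> trans_pow i i x = 1.
Proof. by move=> Xx Ux; rewrite /trans_pow lb_trans_id // expr1n. Qed.

Lemma lb_pow_cocycle i j l x : X x -> lb_open i x -> lb_open j x -> lb_open l x ->
  trans_pow i j x * trans_pow j l x = trans_pow i l x.
Proof. by move=> Xx Ui Uj Ul; rewrite -exprMn lb_trans_cocycle. Qed.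

(* The tensor power kL. *)
Definition lb_pow : line_bundle X :=
  LineBundle (@lb_open_zopen _ _ _ L) (@lb_cover _ _ _ L)
    lb_pow_regular lb_pow_id lb_pow_cocycle.

End Power.

(* Sections in the trivializations: s i represents the section on
   X `&` lb_open i; values elsewhere are irrelevant.  As L and all its powers
   have the same trivializations, the product of a section of aL and of a
   section of bL is their pointwise product. *)

Definition presection (R : realType) (n : nat) (X : set (pspace R n))
    (L : line_bundle X) : Type := lb_index L -> pspace R n -> R[i].

(* Membership in H^0(X, L). *)
Definition is_section (R : realType) (n : nat) (X : set (pspace R n))
    (L : line_bundle X) (s : presection L) : Prop :=
  (forall i, regular_on (X `&` lb_open (l := L) i) (s i)) /\
  (forall i j x, X x -> lb_open i x -> lb_open j x ->
     s i x = lb_trans i j x * s j x).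

Definition effective (R : realType) (n : nat) (X : set (pspace R n))
    (L : line_bundle X) : Prop :=
  exists2 s : presection L, is_section s &
    exists i x, [/\ X x, lb_open i x & s i x != 0].

(* gen_product k t: t is a product, of total degree k, of sections belonging
   to H^0(X, L) or H^0(X, 2L). *)
Inductive gen_product (R : realType) (n : nat) (X : set (pspace R n))
    (L : line_bundle X) : nat -> presection L -> Prop :=
| gen_product1 (s : presection L) : is_section (L := L) s -> gen_product 1 s
| gen_product2 (s : presection L) : is_section (L := lb_pow L 2) s -> gen_product 2 s
| gen_productM a b (s t : presection L) : gen_product a s -> gen_product b t ->
    gen_product (a + b) (fun i x => s i x * t i x).

Definition two_generated (R : realType) (n : nat) (X : set (pspace R n))
    (L : line_bundle X) : Prop :=
  forall (k : nat) (s : presection L), (0 < k)%N -> is_section (L := lb_pow L k) s ->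
    exists (m : nat) (c : 'I_m -> R[i]) (t : 'I_m -> presection L),
      (forall j, gen_product k (t j)) /\
      (forall i x, X x -> lb_open i x -> s i x = \sum_(j < m) c j * t j i x).

(* phi x = (s_0(x) : ... : s_N(x)) for all x in X, the s_j having no common
   zero on X. *)
Definition given_by (R : realType) (n N : nat) (X : set (pspace R n))
    (L : line_bundle X) (s : 'I_N.+1 -> presection L)
    (phi : pspace R n -> pspace R N) : Prop :=
  forall i x, X x -> lb_open i x ->
    let v : 'rV[R[i]]_N.+1 := \row_(j < N.+1) s j i x in
    v != 0 /\ val (phi x) = <[v]>%VS.

(* Hartshorne II.5 and II.7: some sections of L define an immersion phi into a
   projective space, so that L is the pullback of O(1) under phi. *)
Definition very_ample (R : realType) (n : nat) (X : set (pspace R n))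
    (L : line_bundle X) : Prop :=
  exists (N : nat) (s : 'I_N.+1 -> presection L) (phi : pspace R n -> pspace R N),
    [/\ forall j, is_section (s j), given_by s phi & immersion X phi].

Definition ample (R : realType) (n : nat) (X : set (pspace R n))
    (L : line_bundle X) : Prop :=
  exists2 m : nat, (0 < m)%N & very_ample (lb_pow L m).

(* Irreducible sets are connected, so connectedness is part of
   projective_variety. *)
Definition polarized_manifold (R : realType) (n : nat) (M : set (pspace R n))
    (L : line_bundle M) : Prop :=
  [/\ projective_variety M, smooth M & ample L].

(* Main.v *)
(* Let phi = (s_0 : ... : s_N) be an immersion given by sections of mL.  The
   products s_a s_b are sections of 2mL, so by 2-generation they are linear
   combinations of products of sections of L and 2L; as 2m is even, the factors
   from L can be paired up, and s_a s_b = P_ab(t) with P_ab homogeneous of degree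
   m and t_0, ..., t_K sections of 2L.  The t_j have no common zero, and
   tau = (t_0 : ... : t_K) is an immersion since phi is recovered from tau as
   (P_i0 : ... : P_iN) wherever s_i does not vanish. *)
Require Import Defs.
From mathcomp Require Import all_boot all_order all_algebra.
From mathcomp Require Import mpoly complex ring.
From mathcomp Require Import boolp classical_sets reals.

Set Implicit Arguments.
Unset Strict Implicit.
Unset Printing Implicit Defensive.

Import Order.TTheory GRing.Theory Num.Theory.
Local Open Scope classical_set_scope.
Local Open Scope ring_scope.
Local Open Scope complex_scope.

(** * Homogeneous coordinates and homogeneous polynomials *)

Lemma hcoord_vline (R : realType) (n : nat) (x : pspace R n) (v : 'I_n.+1 -> R[i]) :
  \row_j v j != 0 -> val x = <[\row_j v j]>%VS ->
  exists2 c : R[i], c != 0 & forall j, hcoord x j = c * v j.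
Proof.
move=> v0 xE; have : vpick (val x) \in val x by exact: memv_pick.
rewrite {2}xE => /vlineP[c cE]; exists c; last first.
  by move=> j; rewrite /hcoord cE !mxE.
apply/eqP => c0; move: cE; rewrite c0 scale0r => /eqP.
by rewrite vpick0 xE -dimv_eq0 dim_vline v0.
Qed.

Lemma hcoord_neq0 (R : realType) (n : nat) (x : pspace R n) :
  exists j, hcoord x j != 0.
Proof.
have : vpick (val x) != 0 by rewrite vpick0 -dimv_eq0 (eqP (valP x)).
by move=> /rV0Pn[j]; exists j.
Qed.

(** Both lines have dimension 1, so one inclusion between them suffices, and proportionality of the
    representatives gives it for every [c]. *)
Lemma hcoord_inj (R : realType) (n : nat) (x y : pspace R n) (c : R[i]) :
  (forall j, hcoord x j = c * hcoord y j) -> x = y.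
Proof.
move=> xy; apply/val_inj/eqP; rewrite eqEdim.
rewrite (eqP (valP x)) (eqP (valP y)) leqnn andbT.
have px : vpick (val x) != 0 by rewrite vpick0 -dimv_eq0 (eqP (valP x)).
have -> : val x = <[vpick (val x)]>%VS.
  apply/eqP; rewrite eq_sym eqEdim dim_vline px (eqP (valP x)) andbT.
  by rewrite -memvE memv_pick.
have -> : vpick (val x) = c *: vpick (val y).
  by apply/rowP => j; rewrite mxE; exact: xy.
by rewrite -memvE memvZ// memv_pick.
Qed.

Lemma pspace_of_vector (R : realType) (n : nat) (v : 'I_n.+1 -> R[i]) :
  (exists j, v j != 0) -> exists x : pspace R n, val x = <[\row_j v j]>%VS.
Proof.
move=> [j vj].
have v0 : \row_j v j != 0 by apply/rV0Pn; exists j; rewrite mxE.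
have d1 : \dim <[\row_j v j]>%VS == 1%N by rewrite dim_vline v0.
by exists (exist (fun l : {vspace 'rV[R[i]]_n.+1} => \dim l == 1%N) _ d1).
Qed.

Lemma meval_homog_scale (R : realType) (n d : nat) (p : {mpoly R[i][n]}) (c : R[i])
    (v w : 'I_n -> R[i]) :
  p \is d.-homog -> (forall j, w j = c * v j) -> p.@[w] = c ^+ d * p.@[v].
Proof.
move=> hp wE; rewrite !mevalE mulr_sumr !big_seq; apply: eq_bigr => m mp.
have -> : \prod_i w i ^+ m i = c ^+ d * \prod_i v i ^+ m i.
  have -> : d = (\sum_i m i)%N by rewrite -mdegE; exact/esym/(dhomog_mf hp mp).
  rewrite -prodrXr -big_split /=.
  by apply: eq_bigr => i _; rewrite wE exprMn.
by rewrite mulrCA.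
Qed.

Lemma homogeneousM (R : realType) (n : nat) (p q : {mpoly R[i][n.+1]}) :
  homogeneous p -> homogeneous q -> homogeneous (p * q).
Proof. by move=> [d hp] [e hq]; exists (d + e)%N; exact: dhomogM. Qed.

Lemma dhomog_prod_const (R : realType) (n d : nat) (I : finType)
    (p : I -> {mpoly R[i][n]}) :
  (forall i, p i \is d.-homog) -> \prod_i p i \is (d * #|I|).-homog.
Proof.
move=> hp; rewrite cardT -big_enum /=.
elim: (enum I) => [|i l IHl]; first by rewrite big_nil muln0 dhomog1.
by rewrite big_cons mulnS; apply: dhomogM.
Qed.

Lemma dhomog_comp (R : realType) (n k d e : nat) (p : {mpoly R[i][n]})
    (u : n.-tuple {mpoly R[i][k]}) :
  p \is d.-homog -> (forall i, tnth u i \is e.-homog) ->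
  p \mPo u \is (d * e).-homog.
Proof.
move=> hp hu; rewrite comp_mpolyEX big_seq; apply: rpred_sum => m mp.
apply: dhomogZ; rewrite comp_mpolyX.
have -> : d = (\sum_i m i)%N by rewrite -mdegE; exact/esym/(dhomog_mf hp mp).
elim/big_ind2 : _ => [|p1 a p2 b h1 h2|i _].
- by rewrite mul0n dhomog1.
- by rewrite mulnDl; apply: dhomogM.
- by rewrite mulnC; apply: dhomogMn.
Qed.

(** * Relatively open sets and regular functions *)

(** The subspace topology of [Y] in pointwise form, by principal neighbourhoods. The form [g] can
    then be multiplied into numerators and denominators to confine a formula to [A]. *)
Definition rel_open (R : realType) (n : nat) (Y A : set (pspace R n)) : Prop :=
  forall x, Y x -> A x -> exists2 g : {mpoly R[i][n.+1]}, homogeneous g &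
    g.@[hcoord x] != 0 /\ forall y, Y y -> g.@[hcoord y] != 0 -> A y.

Lemma zopen_principal (R : realType) (n : nat) (U : set (pspace R n)) (x : pspace R n) :
  zopen U -> U x -> exists2 g : {mpoly R[i][n.+1]}, homogeneous g &
    g.@[hcoord x] != 0 /\ forall y, g.@[hcoord y] != 0 -> U y.
Proof.
move=> [S hS UE] Ux; have : ~ (~` U) x by apply.
rewrite UE => /existsNP[g /not_implyP[Sg /eqP gx]].
exists g; first exact: hS.
split=> // y; apply: contra_neqP => nUy.
by have : (~` U) y by []; rewrite UE; apply.
Qed.

(** A singleton [S] gives a principal open set, a general [S] a union of such sets. *)
Lemma zopen_nonvanishing (R : realType) (n : nat) (S : set {mpoly R[i][n.+1]}) :
  (forall p, S p -> homogeneous p) ->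
  zopen [set x | exists2 p, S p & p.@[hcoord x] != 0].
Proof.
move=> hS; exists S => //; apply/seteqP; split=> x /=.
  by move=> H p Sp; apply: contra_notP H => /eqP px; exists p.
by move=> H [p Sp]; rewrite H// eqxx.
Qed.

Lemma rel_openP (R : realType) (n : nat) (Y A : set (pspace R n)) :
  rel_open Y A <-> exists2 U, zopen U & Y `&` A = Y `&` U.
Proof.
split=> [oA|[U oU YA] x Yx Ax]; last first.
  have : (Y `&` A) x by []; rewrite YA => -[_ Ux].
  have [g hg [gx gU]] := zopen_principal oU Ux.
  exists g => //; split=> // y Yy /gU Uy.
  by have : (Y `&` U) y by []; rewrite -YA => -[].
(* The open set is the union of all principal open sets whose trace on [Y] lies in [A]. *)
pose S := [set g : {mpoly R[i][n.+1]} | homogeneous g /\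
  forall y, Y y -> g.@[hcoord y] != 0 -> A y].
exists [set x | exists2 p, S p & p.@[hcoord x] != 0].
  by apply: zopen_nonvanishing => p [].
apply/seteqP; split=> x /= [Yx].
  by move=> /(oA _ Yx)[g hg [gx gA]]; split=> //; exists g.
by move=> [g [hg gA] gx]; split=> //; exact: gA.
Qed.

(* The denominator also serves as the equation of the neighbourhood. *)
Lemma regular_onP (R : realType) (n : nat) (Y : set (pspace R n)) (f : pspace R n -> R[i]) :
  regular_on Y f <-> forall x, Y x -> exists (d : nat) (p q : {mpoly R[i][n.+1]}),
    [/\ p \is d.-homog, q \is d.-homog, q.@[hcoord x] != 0 &
        forall y, Y y -> q.@[hcoord y] != 0 -> f y = p.@[hcoord y] / q.@[hcoord y]].
Proof.
split=> rf x Yx.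
  have [W [oW Wx [d [p [q [hp hq E]]]]]] := rf x Yx.
  have [g [e hg] [gx gW]] := zopen_principal oW Wx.
  (* The factor [g] leaves the quotient unchanged and makes the denominator vanish outside [W],
     where [p / q] need not represent [f]. *)
  exists (d + e)%N, (p * g), (q * g).
  split; [exact: dhomogM | exact: dhomogM | |].
    by rewrite mevalM mulf_neq0// (E x Yx Wx).1.
  move=> y Yy; rewrite !mevalM mulf_eq0 negb_or => /andP[qy gy].
  by rewrite -mulf_div divff// mulr1 (E y Yy (gW _ gy)).2.
have [d [p [q [hp hq qx E]]]] := rf x Yx.
exists [set y | exists2 g, [set q] g & g.@[hcoord y] != 0]; split.
- by apply: zopen_nonvanishing => _ ->; exists d.
- by exists q.
exists d, p, q; split=> // y Yy [_ -> qy]; split=> //; exact: E.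
Qed.

Lemma regular_on_sub (R : realType) (n : nat) (Y Y' : set (pspace R n)) f :
  Y' `<=` Y -> regular_on Y f -> regular_on Y' f.
Proof.
move=> YY' /regular_onP rf; apply/regular_onP => x /YY' Yx.
have [d [p [q [hp hq qx E]]]] := rf x Yx.
by exists d, p, q; split=> // y /YY'; exact: E.
Qed.

Lemma eq_regular_on (R : realType) (n : nat) (Y : set (pspace R n)) f g :
  (forall x, Y x -> f x = g x) -> regular_on Y f -> regular_on Y g.
Proof.
move=> fg /regular_onP rf; apply/regular_onP => x Yx.
have [d [p [q [hp hq qx E]]]] := rf x Yx.
by exists d, p, q; split=> // y Yy qy; rewrite -fg// E.
Qed.

Lemma regular_on_local (R : realType) (n : nat) (Y : set (pspace R n)) f :
  (forall x, Y x -> exists2 A, rel_open Y A /\ A x & regular_on (Y `&` A) f) ->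
  regular_on Y f.
Proof.
move=> loc; apply/regular_onP => x Yx.
have [A [oA Ax] /regular_onP rf] := loc x Yx.
have [g [e hg] [gx gA]] := oA x Yx Ax.
have [d [p [q [hp hq qx E]]]] := rf x (conj Yx Ax).
exists (d + e)%N, (p * g), (q * g).
split; [exact: dhomogM | exact: dhomogM | by rewrite mevalM mulf_neq0 |].
move=> y Yy; rewrite !mevalM mulf_eq0 negb_or => /andP[qy gy].
by rewrite -mulf_div divff// mulr1 E//; split=> //; exact: gA.
Qed.

Lemma regular_on_cst (R : realType) (n : nat) (Y : set (pspace R n)) (c : R[i]) :
  regular_on Y (fun=> c).
Proof.
apply/regular_onP => x Yx; exists 0%N, c%:MP, 1; split=> [| | |y _ _].
- by rewrite -[c%:MP]mulr1 mul_mpolyC dhomogZ// dhomog1.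
- exact: dhomog1.
- by rewrite meval1 oner_neq0.
- by rewrite mevalC meval1 divr1.
Qed.

Lemma regular_onD (R : realType) (n : nat) (Y : set (pspace R n)) f g :
  regular_on Y f -> regular_on Y g -> regular_on Y (fun x => f x + g x).
Proof.
move=> /regular_onP rf /regular_onP rg; apply/regular_onP => x Yx.
have [d [p [q [hp hq qx E]]]] := rf x Yx.
have [d' [p' [q' [hp' hq' qx' E']]]] := rg x Yx.
exists (d + d')%N, (p * q' + p' * q), (q * q'); split.
- by apply: dhomogD; [exact: dhomogM | rewrite addnC; exact: dhomogM].
- exact: dhomogM.
- by rewrite mevalM mulf_neq0.
move=> y Yy; rewrite mevalD !mevalM mulf_eq0 negb_or => /andP[qy qy'].
by rewrite E// E'// addf_div.
Qed.

Lemma regular_onM (R : realType) (n : nat) (Y : set (pspace R n)) f g :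
  regular_on Y f -> regular_on Y g -> regular_on Y (fun x => f x * g x).
Proof.
move=> /regular_onP rf /regular_onP rg; apply/regular_onP => x Yx.
have [d [p [q [hp hq qx E]]]] := rf x Yx.
have [d' [p' [q' [hp' hq' qx' E']]]] := rg x Yx.
exists (d + d')%N, (p * p'), (q * q'); split.
- exact: dhomogM.
- exact: dhomogM.
- by rewrite mevalM mulf_neq0.
move=> y Yy; rewrite !mevalM mulf_eq0 negb_or => /andP[qy qy'].
by rewrite E// E'// mulf_div.
Qed.

Lemma regular_onV (R : realType) (n : nat) (Y : set (pspace R n)) f :
  (forall x, Y x -> f x != 0) -> regular_on Y f -> regular_on Y (fun x => (f x)^-1).
Proof.
move=> f0 /regular_onP rf; apply/regular_onP => x Yx.
have [d [p [q [hp hq qx E]]]] := rf x Yx.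
have px : p.@[hcoord x] != 0.
  by apply: contraNneq (f0 x Yx) => px; rewrite E// px mul0r.
exists (d + d)%N, (q * q), (p * q).
split; [exact: dhomogM | exact: dhomogM | by rewrite mevalM mulf_neq0 |].
move=> y Yy; rewrite !mevalM mulf_eq0 negb_or => /andP[py qy].
by rewrite -mulf_div divff// mulr1 E// invf_div.
Qed.

Lemma regular_on_meval (R : realType) (n k : nat) (Y : set (pspace R n))
    (t : 'I_k -> pspace R n -> R[i]) (p : {mpoly R[i][k]}) :
  (forall j, regular_on Y (t j)) -> regular_on Y (fun x => p.@[fun j => t j x]).
Proof.
move=> rt; apply: (@eq_regular_on _ _ _
  (fun x => \sum_(m <- msupp p) p@_m * \prod_i t i x ^+ m i)).
  by move=> x _; rewrite mevalE.
elim: (msupp p : seq _) => [|m l IHl].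
  by under [X in regular_on _ X]funext do rewrite big_nil; exact: regular_on_cst.
under [X in regular_on _ X]funext do rewrite big_cons.
apply: regular_onD => //; apply: regular_onM; first exact: regular_on_cst.
elim: (index_enum _) => [|i r IHr].
  by under [X in regular_on _ X]funext do rewrite big_nil; exact: regular_on_cst.
under [X in regular_on _ X]funext do rewrite big_cons.
by apply: regular_onM => //; apply: regular_onX.
Qed.

Lemma rel_open_nonvanishing (R : realType) (n : nat) (Y : set (pspace R n)) f :
  regular_on Y f -> rel_open Y [set x | f x != 0].
Proof.
move=> /regular_onP rf x Yx /= fx.
have [d [p [q [hp hq qx E]]]] := rf x Yx.
exists (p * q); first by apply: homogeneousM; exists d.
rewrite mevalM mulf_neq0//; last first.
  by apply: contraNneq fx => px; rewrite E// px mul0r.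
split=> // y Yy; rewrite mevalM mulf_eq0 negb_or => /andP[py qy].
by rewrite E// mulf_neq0// invr_neq0.
Qed.

(** [B] is only assumed open relative to the smaller set, because a condition expressed in one
    trivialization makes sense only over its domain. *)
Lemma rel_openI (R : realType) (n : nat) (Y A B : set (pspace R n)) :
  rel_open Y A -> rel_open (Y `&` A) B -> rel_open Y (A `&` B).
Proof.
move=> oA oB x Yx [Ax Bx].
have [g hg [gx gA]] := oA x Yx Ax; have [h hh [hx hB]] := oB x (conj Yx Ax) Bx.
exists (g * h); first exact: homogeneousM.
rewrite mevalM mulf_neq0//; split=> // y Yy.
rewrite mevalM mulf_eq0 negb_or => /andP[gy hy].
by have Ay := gA y Yy gy; split=> //; apply: hB.
Qed.

Lemma zopen_rel_open (R : realType) (n : nat) (Y U : set (pspace R n)) :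
  zopen U -> rel_open Y U.
Proof. by move=> oU; apply/rel_openP; exists U. Qed.

(** * Morphisms *)

(** On a trivializing open set the coordinates of [phi x] are a nonzero multiple of the regular
    functions [s j i]. Vanishing of a form, and quotients of forms of equal degree, can therefore be
    computed on these functions instead. *)
Lemma given_by_morphism (R : realType) (n N : nat) (X : set (pspace R n))
    (L : line_bundle X) (s : 'I_N.+1 -> presection L) (phi : pspace R n -> pspace R N) :
  (forall j, is_section (s j)) -> given_by s phi -> morphism X (phi @` X) phi.
Proof.
move=> secs gs.
have lift i x : X x -> lb_open (l := L) i x ->
    exists2 c : R[i], c != 0 & forall j, hcoord (phi x) j = c * s j i x.
  by move=> Xx Ux; have [v0 E] := gs i x Xx Ux; exact: hcoord_vline v0 E.
have reg i (p : {mpoly R[i][N.+1]}) :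
    regular_on (X `&` lb_open (l := L) i) (fun x => p.@[fun j => s j i x]).
  by apply: regular_on_meval => j; exact: (secs j).1.
have oU i : rel_open X (lb_open (l := L) i) by apply/zopen_rel_open/lb_open_zopen.
have cont V : zopen V -> rel_open X (phi @^-1` V).
  move=> oV x Xx Vx.
  have [i Ux] := lb_cover L Xx.
  have [g [d hg] [gx gV]] := zopen_principal oV Vx.
  have oA := rel_openI (oU i) (rel_open_nonvanishing (reg i g)).
  have val0 y : X y -> lb_open (l := L) i y ->
      (g.@[fun j => s j i y] != 0) = (g.@[hcoord (phi y)] != 0).
    move=> Xy Uy; have [c c0 cE] := lift i y Xy Uy.
    by rewrite (meval_homog_scale hg cE) mulf_eq0 expf_eq0 (negbTE c0) andbF.
  have [h hh [hx hA]] := oA x Xx (conj Ux (etrans (val0 x Xx Ux) gx)).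
  exists h => //; split=> // y Xy /(hA y Xy)[Uy] /=.
  by rewrite val0//; exact: gV.
split.
- by move=> x Xx; exists x.
- by move=> V oV; apply/rel_openP; exact: cont.
move=> V f oV /regular_onP rf; apply: regular_on_local => x [Xx Vx].
have [i Ux] := lb_cover L Xx.
have [d [p [q [hp hq qx E]]]] := rf (phi x) (conj (imageP phi Xx) Vx).
(* [W] is the locus where [q] is nonzero, so that [f] is [p / q] on it. *)
pose W := [set y | exists2 g, [set q] g & g.@[hcoord y] != 0].
have oW : zopen W by apply: zopen_nonvanishing => _ ->; exists d.
exists (lb_open (l := L) i `&` phi @^-1` W).
  split; last by split=> //; exists q.
  move=> y [Xy Vy] Ay; have oA : rel_open X (lb_open (l := L) i `&` phi @^-1` W).
    apply: rel_openI => //; move=> z [Xz Uz] Wz.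
    have [g hg [gz gW]] := cont W oW z Xz Wz.
    by exists g => //; split=> // t [Xt _]; exact: gW.
  have [g hg [gy gA]] := oA y Xy Ay; exists g => //; split=> // z [Xz _]; exact: gA.
apply: (@eq_regular_on _ _ _
    (fun y => p.@[fun j => s j i y] * (q.@[fun j => s j i y])^-1)).
  move=> y [[Xy Vy] [Uy [_ -> qy]]].
  have [c c0 cE] := lift i y Xy Uy.
  rewrite /= (E _ (conj (imageP phi Xy) Vy) qy).
  rewrite (meval_homog_scale hp cE) (meval_homog_scale hq cE).
  by rewrite -mulf_div divff ?mul1r// expf_neq0.
have sub : (X `&` phi @^-1` V) `&` (lb_open (l := L) i `&` phi @^-1` W) `<=`
    X `&` lb_open (l := L) i by move=> y [[? _] [? _]].
apply: regular_onM; first exact: regular_on_sub sub (reg i p).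
apply: regular_onV; last exact: regular_on_sub sub (reg i q).
move=> y [[Xy Vy] [Uy [_ -> qy]]]; apply: contra_neq qy => qy.
have [c c0 cE] := lift i y Xy Uy.
by rewrite (meval_homog_scale hq cE) qy mulr0.
Qed.

Lemma morphism_comp (R : realType) (n m k : nat) (X : set (pspace R n))
    (Y : set (pspace R m)) (Z : set (pspace R k))
    (f : pspace R n -> pspace R m) (g : pspace R m -> pspace R k) :
  morphism X Y f -> morphism Y Z g -> morphism X Z (g \o f).
Proof.
move=> [fY fc fr] [gZ gc gr].
have pre V U : Y `&` (g @^-1` V) = Y `&` U ->
    X `&` ((g \o f) @^-1` V) = X `&` (f @^-1` U).
  move=> E; apply/seteqP; split=> x [Xx Hx]; split=> //=.
    by have : (Y `&` g @^-1` V) (f x) by [split=> //; exact: fY]; rewrite E => -[].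
  by have : (Y `&` U) (f x) by [split=> //; exact: fY]; rewrite -E => -[].
split.
- by move=> x Xx; apply/gZ/fY.
- move=> V oV; have [U oU /pre ->] := gc V oV; exact: fc.
- move=> V r oV rr; have [U oU E] := gc V oV.
  rewrite (pre _ _ E); apply: (fr U (r \o g) oU).
  by rewrite -E; exact: gr.
Qed.

Lemma morphism_rel_open (R : realType) (n m : nat) (X : set (pspace R n))
    (Y : set (pspace R m)) (f : pspace R n -> pspace R m) (V : set (pspace R m)) :
  morphism X Y f -> zopen V -> rel_open X (f @^-1` V).
Proof. by move=> [_ fc _] oV; apply/rel_openP/fc. Qed.

(** * Transferring the immersion property from [phi] to [tau] *)

Lemma mevalXU_homog (R : realType) (n : nat) (j : 'I_n) :
  ('X_j : {mpoly R[i][n]}) \is 1.-homog.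
Proof. by rewrite dhomogX; apply/eqP/mdeg1. Qed.

(* Locally on [tau @` X] the inverse of [tau] is
   [psi \o (P i 0 : ... : P i N)], with [psi] the inverse of [phi].  The image
   of [tau] is open in its closure [Z]: the equations of [phi @` X] pulled back
   along [P i] vanish on [Z], and so do the local equations of
   [tau \o psi \o (P i 0 : ... : P i N) = id]. *)
Lemma immersion_of_quadratic_relation (R : realType) (n N K m : nat)
    (X : set (pspace R n)) (phi : pspace R n -> pspace R N)
    (tau : pspace R n -> pspace R K) (P : 'I_N.+1 -> 'I_N.+1 -> {mpoly R[i][K.+1]}) :
  immersion X phi -> morphism X (tau @` X) tau ->
  (forall a b, P a b \is m.-homog) ->
  (forall x, X x -> exists2 c : R[i], c != 0 & forall a b,
     (P a b).@[hcoord (tau x)] = c * hcoord (phi x) a * hcoord (phi x) b) ->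
  immersion X tau.
Proof.
move=> [[Z [U [[S hS ZE] oU ZU]]] mphi [psi mpsi psiK]] mtau hP tauP.
(* [pull i p] is the pullback of [p] along the rational map (P i 0 : ... : P i N). *)
pose pull i (p : {mpoly R[i][N.+1]}) := p \mPo [tuple P i b | b < N.+1].
have pullE i p w : (pull i p).@[w] = p.@[fun b => (P i b).@[w]].
  by rewrite comp_mpoly_meval; apply: meval_eq => b; rewrite tnth_mktuple.
have pullH i d p : p \is d.-homog -> pull i p \is (d * m).-homog.
  by move=> hp; apply: dhomog_comp => // b; rewrite tnth_mktuple.
clearbody pull.
have pullH' i p : homogeneous p -> homogeneous (pull i p).
  by move=> [d hp]; exists (d * m)%N; exact: pullH.
(* At [tau x], row [i] of [P] is [c * hcoord (phi x) i] times the coordinates of [phi x]. This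
   scalar is nonzero as soon as the diagonal entry [P i i] is. *)
have pull_tau x i : X x -> (P i i).@[hcoord (tau x)] != 0 ->
    exists2 e : R[i], e != 0 & forall d p, p \is d.-homog ->
      (pull i p).@[hcoord (tau x)] = e ^+ d * p.@[hcoord (phi x)].
  move=> Xx; have [c c0 cE] := tauP x Xx; rewrite cE => ci.
  exists (c * hcoord (phi x) i); first by move: ci; rewrite mulf_eq0 => /norP[].
  by move=> d p hp; rewrite pullE; apply: meval_homog_scale hp _ => b; exact: cE.
have Pdiag x : X x -> exists i, (P i i).@[hcoord (tau x)] != 0.
  move=> Xx; have [c c0 cE] := tauP x Xx; have [i xi] := hcoord_neq0 (phi x).
  by exists i; rewrite cE !mulf_neq0.
have phiX x : X x -> (phi @` X) (phi x) by exact: imageP.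
(* Through the forms [pull i 'X_j], the point [tau x] determines the coordinates of [phi x] up to a
   scalar, and [psi] then recovers [x]. *)
have inj x y : X x -> X y -> tau x = tau y -> x = y.
  move=> Xx Xy xy; have [i xi] := Pdiag x Xx.
  have [e e0 eE] := pull_tau x i Xx xi.
  have [e' e'0 e'E] : exists2 e : R[i], e != 0 & forall d p, p \is d.-homog ->
      (pull i p).@[hcoord (tau x)] = e ^+ d * p.@[hcoord (phi y)].
    by rewrite xy; apply: pull_tau; rewrite // -xy.
  suff : phi x = phi y by move=> E; rewrite -(psiK x Xx) -(psiK y Xy) E.
  apply: (@hcoord_inj _ _ _ _ (e' / e)) => j.
  have := eE _ _ (mevalXU_homog R j); rewrite (e'E _ _ (mevalXU_homog R j)).
  rewrite !expr1 !mevalXU => E.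
  by apply: (mulfI e0); rewrite -E mulrA mulrCA divff// mulr1.
split=> //.
(* [Z'] is the Zariski closure of the image of [tau]. *)
- pose Z' := [set y : pspace R K | forall p, (homogeneous p /\
    forall x, X x -> p.@[hcoord (tau x)] = 0) -> p.@[hcoord y] = 0].
  have [S' hS' UE] := oU.
  (* [U'] consists of the points where, for some [i], [P i i] is nonzero and (P i 0 : ... : P i N)
     lies in [U]; here [S'] is a set of equations of the complement of [U]. *)
  pose U' := [set y : pspace R K | exists2 p,
    [set p | exists i f, S' f /\ p = P i i * pull i f] p & p.@[hcoord y] != 0].
  exists Z', U'; split.
  + by exists [set p | homogeneous p /\
      forall x, X x -> p.@[hcoord (tau x)] = 0] => // p [].
  + apply: zopen_nonvanishing => _ [i [f [S'f ->]]].
    by apply: homogeneousM; [exists m | apply: pullH'; exact: hS'].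
  apply/seteqP; split=> [_ [x Xx <-]|y0 [Zy [_ [i [f0 [S'f0 ->]]]]]].
    split; first by move=> p [_]; apply.
    have [i xi] := Pdiag x Xx; have [e e0 eE] := pull_tau x i Xx xi.
    have : (Z `&` U) (phi x) by rewrite -ZU; exact: phiX.
    move=> -[_ Ux]; have : ~ (~` U) (phi x) by apply.
    rewrite UE => /existsNP[f /not_implyP[S'f /eqP fx]].
    exists (P i i * pull i f); first by exists i, f.
    have [d hf] := hS' f S'f.
    by rewrite mevalM mulf_neq0// (eE _ _ hf) mulf_neq0// expf_neq0.
  rewrite mevalM mulf_eq0 negb_or => /andP[Pi fi].
  (* These are the coordinates of a point [z0], the candidate for the image under [phi] of a
     preimage of [y0]. It is first shown to lie in the image of [phi]. *)
  pose v b := (P i b).@[hcoord y0].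
  have [z0 z0E] : exists z : pspace R N, val z = <[\row_b v b]>%VS.
    by apply: pspace_of_vector; exists i.
  have [c c0 cE] : exists2 c : R[i], c != 0 & forall j, hcoord z0 j = c * v j.
    by apply: hcoord_vline z0E; apply/rV0Pn; exists i; rewrite mxE.
  have pull0 d p : p \is d.-homog -> p.@[hcoord z0] = c ^+ d * (pull i p).@[hcoord y0].
    by move=> hp; rewrite pullE; exact: meval_homog_scale.
  have : (Z `&` U) z0.
    split.
      rewrite ZE => p Sp; have [d hp] := hS p Sp; rewrite (pull0 d)//.
      (* The factor [P i i] takes care of the points of [X] where [pull_tau] does not apply; being
         nonzero at [y0], it can be cancelled there. *)
      have : (P i i * pull i p).@[hcoord y0] = 0.
        apply: Zy; split.
          by apply: homogeneousM; [exists m | apply: pullH'; exists d].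
        move=> x Xx; rewrite mevalM; apply/eqP; rewrite mulf_eq0.
        have [//|/= xi] := eqVneq; have [e e0 eE] := pull_tau x i Xx xi.
        have : (Z `&` U) (phi x) by rewrite -ZU; exact: phiX.
        by rewrite ZE (eE _ _ hp) => -[-> // _]; rewrite mulr0.
      by rewrite mevalM => /eqP; rewrite mulf_eq0 (negbTE Pi) => /eqP ->; rewrite mulr0.
    apply: contrapT => nUz; have : (~` U) z0 by [].
    rewrite UE => /(_ f0 S'f0) /eqP; have [d hf] := hS' f0 S'f0.
    by rewrite (pull0 d)// mulf_eq0 expf_eq0 (negbTE c0) andbF (negbTE fi).
  rewrite -ZU => -[x0 Xx0 x0E]; exists x0 => //; apply: contrapT => ny0.
  (* If [y0] differs from [tau x0], their coordinates have a nonzero 2 by 2 minor involving an index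
     [l] at which [tau x0] is nonzero. *)
  have [l wl] := hcoord_neq0 (tau x0).
  have [k yk] : exists k, hcoord y0 k * hcoord (tau x0) l != hcoord y0 l * hcoord (tau x0) k.
    apply: contrapT => /forallNP H; apply: ny0; apply/esym.
    apply: (@hcoord_inj _ _ _ _ (hcoord y0 l / hcoord (tau x0) l)) => j.
    have /negP/negPn/eqP E := H j.
    by rewrite mulrAC -E mulfK.
  pose Dl := [set y : pspace R K | exists2 p, [set 'X_l] p & p.@[hcoord y] != 0].
  have oDl : zopen Dl.
    by apply: zopen_nonvanishing => _ ->; exists 1%N; exact: mevalXU_homog.
  (* The affine coordinate of index [k] in the chart [Dl], composed with [tau \o psi], is regular on
     the image of [phi], hence a quotient [p / q] near [z0]. *)
  have mh := morphism_comp mpsi mtau.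
  have rho : regular_on (tau @` X `&` Dl) (fun y => hcoord y k / hcoord y l).
    apply/regular_onP => y [_ [_ -> yl]]; exists 1%N, 'X_k, 'X_l.
    split=> [| | |z _ _]; rewrite ?mevalXU_homog//.
    by rewrite !mevalXU.
  have [_ _ /(_ _ _ oDl rho)/regular_onP rh] := mh.
  have Dlx0 : Dl (tau x0) by exists 'X_l; rewrite ?mevalXU.
  have Dlz0 : ((tau \o psi) @^-1` Dl) z0 by rewrite -x0E /= psiK.
  have Yz0 : (phi @` X) z0 by rewrite -x0E; exact: phiX.
  have [d [p [q [hp hq qz E]]]] := rh z0 (conj Yz0 Dlz0).
  have [g hg [gz gD]] := morphism_rel_open mh oDl Yz0 Dlz0.
  have [dg hgd] := hg.
  (* The last factor expresses the identity of that coordinate with [p / q]. The others vanish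
     wherever it may fail: [P i i] off the domain of [pull_tau], [g] off the chart, [q] off the
     quotient formula. The product thus vanishes on the closure [Z'], while the first three factors
     are nonzero at [y0]. *)
  have : (P i i * pull i g * pull i q * ('X_k * pull i q - 'X_l * pull i p)).@[hcoord y0] = 0.
    apply: Zy; split.
      apply: homogeneousM.
        apply: homogeneousM; last by apply: pullH'; exists d.
        by apply: homogeneousM; [exists m | exact: pullH'].
      exists (1 + d * m)%N; apply: rpredB; apply: dhomogM;
        by rewrite ?mevalXU_homog// pullH.
    move=> x Xx; rewrite 3!mevalM.
    have [->|xi] := eqVneq (P i i).@[hcoord (tau x)] 0; first by rewrite !mul0r.
    have [e e0 eE] := pull_tau x i Xx xi.
    rewrite (eE _ _ hgd) (eE _ _ hq).
    have [->|gx] := eqVneq g.@[hcoord (phi x)] 0; first by rewrite !(mulr0, mul0r).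
    have [->|qx] := eqVneq q.@[hcoord (phi x)] 0; first by rewrite !(mulr0, mul0r).
    have Dx := gD _ (phiX x Xx) gx.
    have := E _ (conj (phiX x Xx) Dx) qx.
    move: Dx; rewrite /= psiK// => -[_ -> xl] /eqP.
    rewrite mevalXU in xl; rewrite eqr_div// => /eqP H.
    rewrite mevalB !mevalM !mevalXU (eE _ _ hp) (eE _ _ hq).
    rewrite [X in _ * X](_ : _ = e ^+ d * (hcoord (tau x) k * q.@[hcoord (phi x)] -
      p.@[hcoord (phi x)] * hcoord (tau x) l)); last by ring.
    by rewrite H subrr !mulr0.
  move/eqP; rewrite !mevalM !mulf_eq0 (negbTE Pi) /=.
  have pull0N dp r : r \is dp.-homog -> r.@[hcoord z0] != 0 -> (pull i r).@[hcoord y0] == 0 = false.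
    move=> hr rz; apply/negbTE; apply: contra_neq rz => rz.
    by rewrite (pull0 dp)// rz mulr0.
  rewrite (pull0N dg)// (pull0N d)//=; apply/negP.
  rewrite mevalB !mevalM !mevalXU.
  have psiz0 : psi z0 = x0 by rewrite -x0E psiK.
  (* This is the quotient formula at [z0] itself: were the last factor zero at [y0], the minor of
     [yk] would vanish. *)
  have := E _ (conj Yz0 Dlz0) qz; rewrite /= psiz0 => /eqP.
  rewrite eqr_div// => /eqP H.
  apply: contra_neq yk => yk.
  have q0 := negbT (pull0N _ _ hq qz).
  move/eqP: yk; rewrite subr_eq0 => /eqP yk.
  apply: (mulIf qz); rewrite -[RHS]mulrA H (pull0 d q)// (pull0 d p)//.
  transitivity (c ^+ d * hcoord (tau x0) l * (hcoord y0 k * (pull i q).@[hcoord y0])).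
    by ring.
  by rewrite yk; ring.
have [psi' psi'K] : exists psi' : pspace R K -> pspace R n,
    forall x, X x -> psi' (tau x) = x.
  (* [x1] is an arbitrary value for [psi'] off the image of [tau]. *)
  have [x1 _] : exists x : pspace R n, val x = <[\row_(j < n.+1) (1 : R[i])]>%VS.
    by apply: (@pspace_of_vector _ _ (fun=> 1)); exists ord0; exact: oner_neq0.
  have /choice[psi' E] : forall y, exists x, (tau @` X) y -> X x /\ tau x = y.
    move=> y; have [[x Xx xy]|ny] := pselect ((tau @` X) y); first by exists x.
    by exists x1.
  exists psi' => x Xx; have [Xy yx] := E _ (imageP tau Xx).
  exact: inj yx.
have contr i p : homogeneous p -> homogeneous (P i i * pull i p).
  by move=> hp; apply: homogeneousM; [exists m | exact: pullH'].
have cont V : zopen V -> rel_open (tau @` X) (psi' @^-1` V).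
  move=> oV _ [x Xx <-]; rewrite /= psi'K// => Vx.
  have [i xi] := Pdiag x Xx; have [e e0 eE] := pull_tau x i Xx xi.
  have Vz : (psi @^-1` V) (phi x) by rewrite /= psiK.
  have [g hg [gx gV]] := morphism_rel_open mpsi oV (phiX x Xx) Vz.
  have [d hgd] := hg.
  exists (P i i * pull i g); first exact: contr.
  rewrite mevalM (eE _ _ hgd) !mulf_neq0 ?expf_neq0//; split=> // _ [y Xy <-].
  rewrite mevalM mulf_eq0 negb_or => /andP[yi].
  have [e' e'0 e'E] := pull_tau y i Xy yi.
  rewrite (e'E _ _ hgd) mulf_eq0 negb_or => /andP[_ gy].
  by have := gV _ (phiX y Xy) gy; rewrite /= psiK// psi'K.
exists psi' => //; split.
- by move=> _ [x Xx <-]; rewrite psi'K.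
- by move=> V oV; apply/rel_openP; exact: cont.
move=> V f oV rf; apply/regular_onP => _ [[x Xx <-]]; rewrite /= psi'K// => Vx.
have [i xi] := Pdiag x Xx; have [e e0 eE] := pull_tau x i Xx xi.
have [_ _ /(_ V f oV)] := mpsi.
move=> /(_ rf)/regular_onP rpsi.
have Vz : (psi @^-1` V) (phi x) by rewrite /= psiK.
have [d [p [q [hp hq qx E]]]] := rpsi _ (conj (phiX x Xx) Vz).
(* Where [P i i] is nonzero, [pull i p / pull i q] at [tau y] equals [p / q] at [phi y], because
   both pullbacks carry the same power of the scalar from [pull_tau]. The common factor [P i i]
   confines the formula to that locus. *)
exists (m + d * m)%N, (P i i * pull i p), (P i i * pull i q).
split; [exact/dhomogM/pullH | exact/dhomogM/pullH | |].
  by rewrite mevalM (eE _ _ hq) !mulf_neq0 ?expf_neq0.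
move=> _ [[y Xy <-]]; rewrite /= psi'K// => Vy.
rewrite !mevalM mulf_eq0 negb_or => /andP[yi].
have [e' e'0 e'E] := pull_tau y i Xy yi.
rewrite (e'E _ _ hq) (e'E _ _ hp) mulf_eq0 negb_or => /andP[_ qy].
have Vzy : (psi @^-1` V) (phi y) by rewrite /= psiK.
have := E _ (conj (phiX y Xy) Vzy) qy; rewrite /= psiK// => ->.
by rewrite -mulf_div divff// mul1r -mulf_div divff ?mul1r// expf_neq0.
Qed.

(** * Sections *)

Lemma lb_trans_neq0 (R : realType) (n : nat) (X : set (pspace R n)) (L : line_bundle X)
    (i j : lb_index L) x :
  X x -> lb_open i x -> lb_open j x -> lb_trans i j x != 0.
Proof.
move=> Xx Ui Uj; have := lb_trans_cocycle Xx Ui Uj Ui.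
rewrite lb_trans_id// => E; apply/eqP => z; move: E; rewrite z mul0r => /esym/eqP.
by rewrite oner_eq0.
Qed.

Lemma is_section0 (R : realType) (n : nat) (X : set (pspace R n)) (L : line_bundle X) :
  is_section (L := L) (fun _ _ => 0).
Proof. by split=> [i|i j x _ _ _]; [exact: regular_on_cst | rewrite mulr0]. Qed.

Lemma is_section_pow1 (R : realType) (n : nat) (X : set (pspace R n)) (L : line_bundle X)
    (s : presection L) :
  is_section s -> is_section (L := lb_pow L 1) s.
Proof. by move=> [rs ts]; split=> // i j x Xx Ui Uj; rewrite (ts i j)// /= expr1. Qed.

Lemma is_sectionM (R : realType) (n : nat) (X : set (pspace R n)) (L : line_bundle X)
    (a b : nat) (s t : presection L) :
  is_section (L := lb_pow L a) s -> is_section (L := lb_pow L b) t ->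
  is_section (L := lb_pow L (a + b)) (fun i x => s i x * t i x).
Proof.
move=> [rs ts] [rt tt]; split=> [i|i j x Xx Ui Uj].
  by apply: regular_onM; [exact: rs | exact: rt].
by rewrite (ts i j)// (tt i j)//= exprD mulrACA.
Qed.

(** Changing the trivialization multiplies all the values [t j i x] by one nonzero transition
    factor, so the line they span depends on [x] only. *)
Lemma exists_given_by (R : realType) (n K : nat) (X : set (pspace R n))
    (L : line_bundle X) (t : 'I_K.+1 -> presection L) :
  (forall j, is_section (t j)) ->
  (forall i x, X x -> lb_open (l := L) i x -> exists j, t j i x != 0) ->
  exists tau : pspace R n -> pspace R K, given_by t tau.
Proof.
move=> st t0.
have /choice[tau tauP] : forall x, exists y : pspace R K,
    X x -> forall i, lb_open (l := L) i x ->
    \row_j t j i x != 0 /\ val y = <[\row_j t j i x]>%VS.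
  move=> x; have [Xx|nXx] := pselect (X x); last first.
    have [y _] : exists y : pspace R K, val y = <[\row_(j < K.+1) (1 : R[i])]>%VS.
      by apply: (@pspace_of_vector _ _ (fun=> 1)); exists ord0; exact: oner_neq0.
    by exists y.
  have [i Ui] := lb_cover L Xx.
  have [y yE] := @pspace_of_vector _ _ (fun j => t j i x) (t0 i x Xx Ui).
  exists y => _ k Uk; split.
    by have [j tj] := t0 k x Xx Uk; apply/rV0Pn; exists j; rewrite mxE.
  have -> : \row_j t j k x = lb_trans k i x *: \row_j t j i x.
    by apply/rowP => j; rewrite !mxE ((st j).2 k i).
  rewrite yE; apply/eqP; rewrite eqEsubv -!memvE memvZ ?memv_line// andbT.
  apply/vlineP; exists (lb_trans k i x)^-1.
  by rewrite scalerA mulVf ?scale1r// lb_trans_neq0.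
by exists tau => i x Xx Ui; exact: tauP.
Qed.

(* Only sections of [L] can contribute an odd degree, so their number has the
   parity of [k], and they can be paired into sections of [2L]. *)
Lemma gen_product_pairs (R : realType) (n : nat) (X : set (pspace R n))
    (L : line_bundle X) (k : nat) (t : presection L) :
  gen_product k t -> exists (l : seq (presection L)) (a : presection L),
    [/\ ((size l).*2 + odd k)%N = k,
        forall j, is_section (L := lb_pow L 2) (nth (fun _ _ => 0) l j),
        if odd k then is_section a else a = (fun _ _ => 1) &
        forall i x, t i x = a i x * \prod_(u <- l) u i x].
Proof.
elim=> {k t} [s hs|s hs|k1 k2 t1 t2 _ [l1 [a1 [k1E sl1 sa1 t1E]]] _ [l2 [a2 [k2E sl2 sa2 t2E]]]].
- exists [::], s; split=> // [j|i x]; last by rewrite big_nil mulr1.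
  by rewrite nth_nil; exact: is_section0.
- exists [:: s], (fun _ _ => 1); split=> // [[|j]|i x] /=.
  + exact: hs.
  + by rewrite nth_nil; exact: is_section0.
  + by rewrite big_seq1 mul1r.
have sl j : is_section (L := lb_pow L 2) (nth (fun _ _ => 0) (l1 ++ l2) j).
  by rewrite nth_cat; case: ifP => _; [exact: sl1 | exact: sl2].
have sizeE : ((size l1).*2 + odd k1 + ((size l2).*2 + odd k2))%N = (k1 + k2)%N.
  by rewrite k1E k2E.
case o1 : (odd k1) sa1 sizeE => sa1; case o2 : (odd k2) sa2 => sa2 sizeE.
(* Two unpaired sections of L multiply to one more section of 2L. *)
- exists ((fun i x => a1 i x * a2 i x) :: l1 ++ l2), (fun _ _ => 1); split.
  + by rewrite oddD o1 o2 /= size_cat -sizeE doubleS doubleD addnACA addn0 addn2.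
  + case=> [|j] /=; last exact: sl.
    exact: (@is_sectionM _ _ _ L 1 1) (is_section_pow1 sa1) (is_section_pow1 sa2).
  + by rewrite oddD o1 o2.
  + by move=> i x; rewrite t1E t2E big_cons big_cat mul1r mulrACA.
- exists (l1 ++ l2), a1; split=> //.
  + by rewrite oddD o1 o2 /= size_cat -sizeE doubleD addn0 addnAC.
  + by rewrite oddD o1 o2.
  + by move=> i x; rewrite t1E t2E big_cat sa2 mul1r mulrA.
- exists (l1 ++ l2), a2; split=> //.
  + by rewrite oddD o1 o2 /= size_cat -sizeE doubleD addn0 addnA.
  + by rewrite oddD o1 o2.
  + by move=> i x; rewrite t1E t2E big_cat sa1 mul1r mulrCA.
- exists (l1 ++ l2), (fun _ _ => 1); split=> //.
  + by rewrite oddD o1 o2 /= size_cat -sizeE doubleD !addn0.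
  + by rewrite oddD o1 o2.
  + by move=> i x; rewrite t1E t2E big_cat sa1 sa2 !mul1r.
Qed.

Lemma gen_product_even (R : realType) (n : nat) (X : set (pspace R n))
    (L : line_bundle X) (m : nat) (t : presection L) :
  gen_product (m + m) t -> exists u : 'I_m -> presection L,
    (forall k, is_section (L := lb_pow L 2) (u k)) /\
    forall i x, t i x = \prod_k u k i x.
Proof.
move=> /gen_product_pairs[l [a [szE sl + tE]]].
move: szE; rewrite addnn odd_double addn0 => /double_inj sz a1.
exists (fun k => nth (fun _ _ => 0) l k); split=> [k|i x]; first exact: sl.
by rewrite tE a1 mul1r (big_nth (fun _ _ => 0)) sz big_mkord.
Qed.

(** Projective coordinates are indexed by some ['I_K.+1]. Placing [t0] at index 0 provides such an
    indexing even when [I] is empty. *)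
Lemma pointed_ordinal_family (T : Type) (I : finType) (t0 : T) (u : I -> T) :
  exists (K : nat) (t : 'I_K.+1 -> T) (idx : I -> 'I_K.+1),
    (forall i, t (idx i) = u i) /\ forall j, t j = t0 \/ exists i, t j = u i.
Proof.
exists #|I|, (fun j => if unlift ord0 j is Some k then u (enum_val k) else t0).
exists (fun i => lift ord0 (enum_rank i)); split=> [i|j].
  by rewrite liftK enum_rankK.
by case: unliftP => [k _|_]; [right; exists (enum_val k) | left].
Qed.

(** The sections of 2L occurring in the expansions of all the products of two [s a] are collected
    into a single family [t], and each term of an expansion becomes a scalar times a monomial of
    degree [m]. *)
Lemma two_generated_quadratic_relation (R : realType) (n m N : nat)
    (X : set (pspace R n)) (L : line_bundle X) (s : 'I_N.+1 -> presection L) :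
  two_generated L -> (0 < m)%N -> (forall a, is_section (L := lb_pow L m) (s a)) ->
  exists (K : nat) (t : 'I_K.+1 -> presection L)
      (P : 'I_N.+1 -> 'I_N.+1 -> {mpoly R[i][K.+1]}),
    [/\ forall j, is_section (L := lb_pow L 2) (t j),
        forall a b, P a b \is m.-homog &
        forall a b i x, X x -> lb_open (l := L) i x ->
          (P a b).@[fun j => t j i x] = s a i x * s b i x].
Proof.
move=> gen m0 ss.
(* For each pair [ab], [F] packages the number of terms, their coefficients and the [m] factors of
   each term. *)
have /choice[F FP] : forall ab : 'I_N.+1 * 'I_N.+1,
    exists F : {r : nat & (('I_r -> R[i]) * ('I_r -> 'I_m -> presection L))%type},
    (forall j k, is_section (L := lb_pow L 2) ((tagged F).2 j k)) /\
    forall i x, X x -> lb_open (l := L) i x ->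
      s ab.1 i x * s ab.2 i x = \sum_j (tagged F).1 j * \prod_k (tagged F).2 j k i x.
  move=> [a b]; have [|r [c [t [tp E]]]] := gen (m + m)%N _ _ (is_sectionM (ss a) (ss b)).
    by rewrite addn_gt0 m0.
  have /choice[u uP] := fun j => gen_product_even (tp j).
  exists (existT _ r (c, u)); split=> [j k|i x Xx Ui] /=; first exact: (uP j).1.
  by rewrite E//; apply: eq_bigr => j _; rewrite (uP j).2.
(* [I] indexes every factor of every term for every pair; the family [t] lists them all after the
   zero section. *)
pose I := {ab : 'I_N.+1 * 'I_N.+1 & ('I_(tag (F ab)) * 'I_m)%type}.
have [K [t [idx [tE tP]]]] := @pointed_ordinal_family (presection L) I (fun _ _ => 0)
  (fun z => (tagged (F (tag z))).2 (tagged z).1 (tagged z).2).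
pose v ab j k : 'I_K.+1 :=
  idx (existT (fun ab => ('I_(tag (F ab)) * 'I_m)%type) ab (j, k)).
exists K, t, (fun a b => \sum_(j < tag (F (a, b)))
  (tagged (F (a, b))).1 j *: \prod_k 'X_(v (a, b) j k)); split.
- move=> j; have [->|[z ->]] := tP j; first exact: is_section0.
  exact: (FP (tag z)).1.
- move=> a b; apply: rpred_sum => j _; apply: dhomogZ.
  have := @dhomog_prod_const R K.+1 1 _ (fun k => 'X_(v (a, b) j k))
    (fun k => mevalXU_homog _ _).
  by rewrite card_ord mul1n.
- move=> a b i x Xx Ui; rewrite ((FP (a, b)).2 i x)// raddf_sum /=.
  apply: eq_bigr => j _; rewrite mevalZ rmorph_prod /=; congr (_ * _).
  by apply: eq_bigr => k _; rewrite mevalXU tE.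
Qed.

Theorem theorem2p7 (R : realType) (n : nat) (M : set (pspace R n))
    (L : line_bundle M) (hML : polarized_manifold L)
    (hE : effective L) (hG : two_generated L) :
  very_ample (lb_pow L 2).
Proof.
have [_ _ [m m0 [N [s [phi [ss sphi iphi]]]]]] := hML.
have [K [t [P [st hP PE]]]] := two_generated_quadratic_relation hG m0 ss.
have t0 i x : M x -> lb_open (l := L) i x -> exists j, t j i x != 0.
  (* If all [t j] vanished at [x], so would every [P a a], of degree [m > 0], hence the square of
     every [s a], although the [s a] have no common zero. *)
  move=> Mx Ux; apply: contrapT => /forallNP tx.
  have [/rV0Pn[a]] := sphi i x Mx Ux; rewrite mxE => sa _.
  have := PE a a i x Mx Ux; rewrite (meval_homog_scale (c := 0) (v := fun=> 0) (hP a a)).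
    by rewrite expr0n gtn_eqF// mul0r => /esym/eqP; rewrite mulf_eq0 (negbTE sa).
  by move=> j; rewrite mulr0; apply/eqP/negPn/negP/tx.
have [tau ttau] := exists_given_by st t0.
exists K, t, tau; split=> //.
apply: (immersion_of_quadratic_relation iphi _ hP); first exact: given_by_morphism ttau.
move=> x Mx; have [i Ux] := lb_cover L Mx.
have [v0 /(hcoord_vline v0)[c c0 cE]] := ttau i x Mx Ux.
have [w0 /(hcoord_vline w0)[e e0 eE]] := sphi i x Mx Ux.
(* [P a b] has degree [m] in coordinates scaled by [c], and the two coordinates of [phi x] are each
   scaled by [e]. *)
exists (c ^+ m / e ^+ 2); first by rewrite mulf_neq0 ?invr_eq0 ?expf_neq0.
move=> a b; rewrite (meval_homog_scale (hP a b) cE) PE// !eE.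
by field.
Qed.
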